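(* Let $X$ and $Y$ be Tychonoff spaces and let $X$ be a $\Delta$-space. Let $T: C_p(X)\to C_p(Y)$ be a linear continuous surjection. Consider the following assertions. (1) $C_p(X)$ admits a base $\mathcal{U}$ of absolutely convex neighbourhoods of zero such that $\overline{T(U)}\subset 2T(U)$ for each $U\in\mathcal{U}$, where the closure is taken in $C_p(Y)$. (2) $T$ is an open mapping. (3) $C_p(X)$ admits a base $\mathcal{U}$ of absolutely convex closed neighbourhoods of zero such that $T(U)$ is closed in $C_p(Y)$ for each $U\in\mathcal{U}$. Then (3) $\Rightarrow$ (2) and (2) $\Leftrightarrow$ (1).
   Context: For a Tychonoff space $X$, $C(X)$ is the vector space of all continuous functions $X\to\mathbb{R}$, and $C_p(X)$ is $C(X)$ with the topology of pointwise convergence. A topological space $X$ is a $\Delta$-space if for every decreasing sequence $\{D_n : n\in\omega\}$ of subsets of $X$ with empty intersection there is a decreasing sequence $\{V_n : n\in\omega\}$ of open subsets of $X$, also with empty intersection, such that $D_n\subset V_n$ for every $n\in\omega$. *)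

(* Defs.v *)
From HB Require Import structures.
From mathcomp Require Import all_boot all_order all_algebra.
From mathcomp Require Import all_classical all_reals all_analysis.

Set Implicit Arguments.
Unset Strict Implicit.
Unset Printing Implicit Defensive.

Import Order.TTheory GRing.Theory Num.Theory.
Import numFieldNormedType.Exports.

Local Open Scope classical_set_scope.
Local Open Scope ring_scope.

(* [completely_regular_space] separates points from closed sets by a uniformity;
   [uniform_separatorP] turns this into separation by a continuous function
   into [0, 1]. *)
Definition tychonoff_space (X : topologicalType) : Prop :=
  completely_regular_space X /\ hausdorff_space X.

Definition delta_space (X : topologicalType) : Prop :=
  forall D : nat -> set X,
    nonincreasing_seq D -> \bigcap_n D n = set0 ->
    exists V : nat -> set X,
      [/\ forall n, open (V n), nonincreasing_seq V, \bigcap_n V n = set0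
        & forall n, D n `<=` V n].

(* [Cp R X] is an alias of [continuousType X R], so that the topology of
   pointwise convergence and the pointwise vector space structure are attached
   to it alone: [continuousType X R] itself has no canonical topology. *)
Definition Cp (R : realType) (X : topologicalType) : Type := continuousType X R.

Section Cp_structures.
Context (R : realType) (X : topologicalType).

Definition Cp_fun (f : Cp R X) : X -> R := Continuous.sort f.

Definition continuous_fun : {pred X -> R} := mem [set f : X -> R | continuous f].

Definition Cp_Sub (f : X -> R) (cf : f \in continuous_fun) : Cp R X :=
  mkcts (set_mem cf : continuous f).

Let Cp_rect (K : Cp R X -> Type) :
  (forall f (cf : f \in continuous_fun), K (Cp_Sub cf)) -> forall u, K u.
Proof.
move=> KSub u.
have cu : Cp_fun u \in continuous_fun by apply/mem_set; exact: cts_fun.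
by suff <- : Cp_Sub cu = u by []; apply/continuousEP.
Qed.

Let Cp_SubK f (cf : f \in continuous_fun) : Cp_fun (Cp_Sub cf) = f.
Proof. by []. Qed.

HB.instance Definition _ := isSub.Build _ _ (Cp R X) Cp_rect Cp_SubK.
HB.instance Definition _ := [Choice of Cp R X by <:].

Let continuous_fun_submod : submod_closed continuous_fun.
Proof.
split=> [|a f g /set_mem cf /set_mem cg]; apply/mem_set => x.
  exact: cvg_cst.
by apply: cvgD; [apply: cvgZr; exact: cf|exact: cg].
Qed.

HB.instance Definition _ :=
  GRing.isSubmodClosed.Build R (X -> R) continuous_fun continuous_fun_submod.
HB.instance Definition _ := [SubChoice_isSubLmodule of Cp R X by <:].

HB.instance Definition _ :=
  Topological.copy (Cp R X)
    (initial_topology (Cp_fun : Cp R X -> {ptws X -> R})).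

End Cp_structures.

Arguments Cp_fun {R X} f.

Section absolutely_convex.
Context (R : numDomainType) (E : lmodType R).

Definition balanced (U : set E) : Prop :=
  forall (a : R) (x : E), `|a| <= 1 -> U x -> U (a *: x).

Definition absolutely_convex (U : set E) : Prop := convex_set U /\ balanced U.

End absolutely_convex.

(* A base of neighbourhoods of the point [x]; its members need not be open. *)
Definition nbhs_base (T : topologicalType) (x : T) (B : set (set T)) : Prop :=
  B `<=` nbhs x /\ forall A, nbhs x A -> exists2 U, B U & U `<=` A.

Definition open_map (S T : topologicalType) (f : S -> T) : Prop :=
  forall A : set S, open A -> open (f @` A).

(* Main.v *)
Require Import Defs.
From HB Require Import structures.
From mathcomp Require Import all_boot all_order all_algebra.
From mathcomp Require Import all_classical all_reals all_analysis.
From mathcomp Require Import ring lra.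

Import Order.TTheory GRing.Theory Num.Theory.
Import numFieldNormedType.Exports.

(** The pointwise topology is a weak topology: a neighbourhood [U] of [0] in
    [Cp R X] controls only finitely many evaluations. This forces every linear
    surjection [T : Cp R X -> Cp R Y] to be almost open: [closure (T @` U)] is
    a neighbourhood of [0] whenever [U] is an absolutely convex one
    ([nbhs0_closure_image]). In terms of duality, the adjoint of [T] is
    injective, so the functionals on [Cp R Y] whose pullback is a combination
    of the finitely many evaluations controlled by [U] span a
    finite-dimensional space, and the polar of [T @` U] is bounded in it.

    The argument below avoids duals and the bipolar theorem. Say that [y] is
    finitely approximated by [T @` U] if, on each finite set of points, [y]
    agrees with an element of [T @` U]; such a [y] lies in the closure. The set
    [C] of these functions is absolutely convex and absorbing, so it is a
    neighbourhood of [0] as soon as it contains every function vanishing on some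
    finite set [t] ([slab_sub]). Suppose [U] controls evaluation at the points
    of [s], and let [W t] be the space of [u] with [T u = 0] on [t]. The
    restrictions of [W t] to [s] decrease as [t] grows and live in a
    finite-dimensional space, so they are constant from some [t] on
    ([directed_subspaces_stabilize]). If [T x] vanishes on this [t], then for
    each finite [t'] some [v] in [W t'] agrees with [x] on [s]; hence [x - v] is
    in [U], and [T (x - v)] agrees with [T x] on [t'].

    Almost openness turns the closure condition of the first assertion into
    openness at [0], since [closure (T @` U)] is inside a multiple of [T @` U].
    Conversely, if [T] is open and [U] is an absolutely convex neighbourhood of
    [0], then [T @` U] is one too, and such a set [C] satisfies
    [closure C `<=` C + C = 2 C] ([closure_sub_twice]). The third assertion
    implies the first because [T @` U] is then its own closure and, being
    balanced, is contained in its double. *)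

Local Open Scope classical_set_scope.
Local Open Scope ring_scope.

(** * Directed families of subspaces *)

Definition linear_subspace {K : fieldType} {E : lmodType K}
    (W : set E) : Prop :=
  W 0 /\ forall (a : K) (u v : E), W u -> W v -> W (a *: u + v).

(** The images of the members of a downward directed family under
    [u |-> (phi i u)_(i in s)] form a directed family of subspaces of a
    finite-dimensional space, which has a least element. The induction on [s]
    replaces a dimension count: a new functional [phi i] either vanishes on some
    member, where it adds no constraint, or is nonzero somewhere on each member,
    and then the family is first cut down by its kernel. *)
Lemma directed_subspaces_stabilize (K : fieldType) (E : lmodType K) (I : eqType)
    (phi : I -> {scalar E}) (s : seq I) (P : set (set E)) :
  P !=set0 -> (forall W, P W -> linear_subspace W) ->
  (forall V W, P V -> P W -> exists2 Z, P Z & Z `<=` V `&` W) ->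
  exists2 V, P V & forall W, P W -> forall u, V u ->
    exists2 v, W v & forall i, i \in s -> phi i v = phi i u.
Proof.
elim: s P => [|i s IH] P P0 linP dirP.
  case: P0 => V PV; exists V => // W PW u _.
  by exists 0; [exact: (linP _ PW).1|].
have [[V1 PV1 V1i]|noV] :=
    pselect (exists2 V, P V & forall u, V u -> phi i u = 0).
  have [V2 PV2 stabV2] := IH P P0 linP dirP.
  have [V PV sV] := dirP _ _ PV1 PV2.
  exists V => // W PW u /sV[V1u V2u].
  have [Z PZ sZ] := dirP _ _ PW PV1.
  have [v /sZ[Wv V1v] vu] := stabV2 _ PZ _ V2u.
  exists v => // j; rewrite inE => /predU1P[->|]; last exact: vu.
  by rewrite !V1i.
pose kerP := [set W `&` [set u | phi i u = 0] | W in P].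
have [| | |_ [V PV <-] stabV] := IH kerP.
- by case: P0 => V PV; exists (V `&` [set u | phi i u = 0]); exists V.
- move=> _ [W PW <-]; have [W0 linW] := linP _ PW.
  split=> [|a u v [Wu iu] [Wv iv]]; split => //=; first by rewrite linear0.
    exact: linW.
  by rewrite linearP /= iu iv; ring.
- move=> _ _ [V PV <-] [W PW <-]; have [Z PZ sZ] := dirP _ _ PV PW.
  exists (Z `&` [set u | phi i u = 0]); first by exists Z.
  by move=> u [/sZ[]].
(* A vector [h] of a member below both [V] and [W] has [phi i h != 0], so
   subtracting a multiple of [h] moves [u] into the kernel of [phi i]. *)
exists V => // W PW u Vu.
have [Z PZ sZ] := dirP _ _ PW PV.
have [h Zh ih] : exists2 h, Z h & phi i h != 0.
  apply: contrapT => noh; apply: noV; exists Z => // h Zh.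
  by apply: contrapT => /eqP ih; apply: noh; exists h.
set a := phi i u / phi i h.
have kerZ : kerP (Z `&` [set u | phi i u = 0]) by exists Z.
have [|v [Zv iv] vu] := stabV _ kerZ (- a *: h + u).
  split; first by apply: (linP _ PV).2 => //; exact: (sZ _ Zh).2.
  by rewrite /= linearP /= /a; field.
exists (a *: h + v); first by apply: (sZ _ _).1; apply: (linP _ PZ).2.
move=> j; rewrite inE linearP => /predU1P[->|/vu ->] /=.
  by rewrite iv /a; field.
by rewrite linearP /=; ring.
Qed.

(** * Absolutely convex sets and slabs *)

Section absolutely_convex.
Context {R : realFieldType} {E : lmodType R}.
Implicit Types (U C : set E).

Lemma absolutely_convexP U : absolutely_convex U <->
  forall (a b : R) (x y : E), `|a| + `|b| <= 1 -> U x -> U y ->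
    U (a *: x + b *: y).
Proof.
split=> [[cU bU] a b x y ab Ux Uy|U2].
  have [s0|s0] := eqVneq (`|a| + `|b|) 0.
    have /eqP a0 : a == 0.
      rewrite -normr_eq0; apply/eqP.
      by have := normr_ge0 a; have := normr_ge0 b; lra.
    have /eqP b0 : b == 0.
      rewrite -normr_eq0; apply/eqP.
      by have := normr_ge0 a; have := normr_ge0 b; lra.
    by rewrite a0 b0 !scale0r addr0 -(scale0r x); apply: bU; rewrite ?normr0.
  (* [a x + b y = s (k sg(a) x + (1 - k) sg(b) y)] with [k = |a| / s]. *)
  set s := `|a| + `|b| in ab s0.
  have sp : 0 < s by rewrite lt_neqAle eq_sym s0 addr_ge0.
  have k0 : 0 <= `|a| / s by rewrite divr_ge0 // ltW.
  have k1 : `|a| / s <= 1 by rewrite ler_pdivrMr // mul1r lerDl.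
  have sUx (c : R) z : U z -> U (Num.sg c *: z).
    by move=> Uz; apply: bU => //; rewrite normr_sg; case: (c != 0).
  have := cU _ _ (Itv01 k0 k1) (mem_set (sUx a _ Ux)) (mem_set (sUx b _ Uy)).
  move=> /set_mem/(bU s); rewrite /conv /= gtr0_norm // => /(_ ab); congr U.
  rewrite scalerDr !scalerA /unstable.onem; congr (_ *: _ + _ *: _).
    by rewrite [in RHS](numEsg a); field.
  have -> : 1 - `|a| / s = `|b| / s by rewrite /s; field.
  by rewrite [in RHS](numEsg b); field.
split=> [x y k /set_mem Ux /set_mem Uy|a x a1 Ux].
  apply/mem_set/U2 => //.
  have [k0 k1] : 0 <= k%:num /\ k%:num <= 1 by split.
  by rewrite /unstable.onem !ger0_norm ?subr_ge0 //; lra.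
rewrite -[_ *: _]addr0 -(scale0r x).
by apply: U2 => //; rewrite normr0 addr0.
Qed.

End absolutely_convex.

Definition absorbing (R : numDomainType) (E : lmodType R) (C : set E) : Prop :=
  forall x, exists2 e : R, 0 < e & C (e *: x).
Arguments absorbing {R E}.

Definition slab {R : numDomainType} {E : lmodType R} {I : eqType}
    (phi : I -> {scalar E}) (s : seq I) (e : R) : set E :=
  [set x | forall i, i \in s -> `|phi i x| < e].

Section slab.
Context {R : realFieldType} {E : lmodType R} {I : eqType}.
Context (phi : I -> {scalar E}).

Lemma absorbing_slab (s : seq I) (e : R) : 0 < e -> absorbing (slab phi s e).
Proof.
move=> e0 x; elim: s => [|i s [d d0 IH]]; first by exists 1.
have q0 : 0 < 1 + `|phi i x| by rewrite ltr_pwDl.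
pose d' := Num.min d (e / (1 + `|phi i x|)).
have d'0 : 0 < d' by rewrite lt_min d0 divr_gt0.
exists d' => // j; rewrite inE linearZ /= normrM (gtr0_norm d'0).
move=> /predU1P[->|js].
  apply: (@lt_le_trans _ _ (d' * (1 + `|phi i x|))).
    by rewrite ltr_pM2l // ltrDr.
  by rewrite -ler_pdivlMr // ge_min lexx orbT.
apply: le_lt_trans (IH _ js).
by rewrite linearZ /= normrM (gtr0_norm d0) ler_wpM2r // ge_min lexx.
Qed.

Lemma absolutely_convex_slab (s : seq I) (e : R) :
  0 < e -> absolutely_convex (slab phi s e).
Proof.
move=> e0; apply/absolutely_convexP => a b x y ab xs ys i si.
have [xi yi] := (xs _ si, ys _ si).
rewrite linearD !linearZ /=.
apply: le_lt_trans (ler_normD _ _) _; rewrite !normrM.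
have : `|a| * `|phi i x| + `|b| * `|phi i y| <=
    (`|a| + `|b|) * Num.max `|phi i x| `|phi i y|.
  by rewrite mulrDl lerD // ler_wpM2l // le_max lexx ?orbT.
move=> /le_lt_trans; apply.
apply: (@le_lt_trans _ _ (1 * Num.max `|phi i x| `|phi i y|)).
  by rewrite ler_wpM2r // le_max normr_ge0.
by rewrite mul1r gt_max xi yi.
Qed.

(** In a finite-dimensional space an absolutely convex absorbing set is a
    neighbourhood of [0]; here this is applied modulo the common kernel of the
    [phi i]. One functional [phi i] is treated at a time: unless the others
    determine it, some [e] has [phi i e = 1] and is killed by the others, and
    [p x = x - phi i x *: e] projects onto the kernel of [phi i]. Then [x] is
    the midpoint of [2 *: p x], handled by induction, and of a multiple of [e],
    handled by absorption. *)
Lemma slab_sub (s : seq I) (C : set E) :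
  absolutely_convex C -> absorbing C ->
  (forall x, (forall i, i \in s -> phi i x = 0) -> C x) ->
  exists2 e : R, 0 < e & slab phi s e `<=` C.
Proof.
elim: s C => [|i s IH] C acC absC kerC.
  by exists 1 => // x _; apply: kerC.
have [iK|/existsNP[e' /not_implyP[ker_e' /eqP ie']]] := pselect
    (forall x, (forall j, j \in s -> phi j x = 0) -> phi i x = 0).
  have [|e e0 se] := IH C acC absC.
    move=> x xs; apply: kerC => j; rewrite inE => /predU1P[->|/xs//].
    exact: iK.
  by exists e => // x xs; apply: se => j sj; apply: xs; rewrite inE sj orbT.
have [e ie ker_e] : exists2 e, phi i e = 1 & forall j, j \in s -> phi j e = 0.
  exists ((phi i e')^-1 *: e'); first by rewrite linearZ /= mulVf.
  by move=> j sj; rewrite linearZ /= (ker_e' j) // mulr0.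
pose p x : E := x - phi i x *: e.
have pD a b x y : p (a *: x + b *: y) = a *: p x + b *: p y.
  rewrite /p; have -> : phi i (a *: x + b *: y) = a * phi i x + b * phi i y.
    by rewrite linearD !linearZ.
  by rewrite scalerDl -!scalerA !scalerBr opprD addrACA.
have ip x : phi i (p x) = 0 by rewrite linearB linearZ /= ie mulr1 subrr.
have sp x j : j \in s -> phi j (p x) = phi j x.
  by move=> sj; rewrite linearB linearZ /= ker_e // mulr0 subr0.
have [a0 a00 Ca0] := absC e.
have /absolutely_convexP acC2 := acC.
have [| | |d d0 sd] := IH [set x | C (p x)].
- by apply/absolutely_convexP => a b x y ab /= Cx Cy; rewrite pD; apply: acC2.
- move=> x /=; have [c c0 Cc] := absC (p x); exists c => //=.
  rewrite -[c *: x]addr0 -(scale0r x) pD scale0r addr0 //.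
- move=> x xs /=; apply: kerC => j; rewrite inE => /predU1P[->//|sj].
  by rewrite sp // xs.
pose r := Num.min (d / 2) (a0 / 2).
have r0 : 0 < r by rewrite lt_min !divr_gt0.
have [rd ra] : r <= d / 2 /\ r <= a0 / 2 by rewrite !ge_min !lexx orbT.
exists r => // x xs.
have -> : x = 2^-1 *: p (2 *: x) + (phi i x / a0) *: (a0 *: e).
  have -> : p (2 *: x) = 2 *: p x.
    by have := pD 2 0 x x; rewrite !scale0r !addr0.
  rewrite !scalerA mulVf // ?scale1r divfK ?gt_eqF //.
  by rewrite /p subrK.
apply: acC2 => //.
  rewrite normrM [`|a0^-1|]gtr0_norm ?invr_gt0 // [`|2^-1|]gtr0_norm //.
  have : `|phi i x| / a0 <= 2^-1.
    rewrite ler_pdivrMr // mulrC; apply: le_trans ra.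
    by apply/ltW/xs; rewrite inE eqxx.
  lra.
apply: sd => j sj; rewrite linearZ /= normrM gtr0_norm //.
have : `|phi j x| < r by apply: xs; rewrite inE sj orbT.
lra.
Qed.

End slab.

(** * Almost openness of linear surjections *)

(** The conclusion says that [slab psi t d] lies in the closure of [T @` U] for
    the topology generated by the [psi j], in the strong form where the
    approximation is exact on each finite set [t'] of indices. *)
Lemma linear_surjection_almost_open (R : realFieldType) (E F : lmodType R)
    (I J : eqType) (phi : I -> {scalar E}) (psi : J -> {scalar F})
    (T : {linear E -> F}) (s : seq I) (e : R) (U : set E) :
  range T = setT -> absolutely_convex U -> 0 < e -> slab phi s e `<=` U ->
  exists t : seq J, exists2 d : R, 0 < d & forall y, slab psi t d y ->
    forall t' : seq J, exists2 u, U u &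
      forall j, j \in t' -> psi j (T u) = psi j y.
Proof.
move=> surjT acU e0 sU.
pose W (t : seq J) := [set u | forall j, j \in t -> psi j (T u) = 0].
have linW t : linear_subspace (W t).
  split=> [j _|a u v Wu Wv j tj]; first by rewrite !linear0.
  by rewrite !linearP /= Wu // Wv //; ring.
have [| | |_ [t _ <-] stabW] :=
  @directed_subspaces_stabilize _ _ _ phi s (range W).
- by exists (W [::]); exists [::].
- by move=> _ [t _ <-].
- move=> _ _ [t1 _ <-] [t2 _ <-].
  exists (W (t1 ++ t2)); first by exists (t1 ++ t2).
  by move=> u Wu; split=> j tj; apply: Wu; rewrite mem_cat tj ?orbT.
pose C := [set y | forall t' : seq J, exists2 u, U u &
  forall j, j \in t' -> psi j (T u) = psi j y].
have /absolutely_convexP acU2 := acU.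
have acC : absolutely_convex C.
  apply/absolutely_convexP => a b x y ab Cx Cy t'.
  have [[u Uu ux] [v Uv vy]] := (Cx t', Cy t').
  exists (a *: u + b *: v); first exact: acU2.
  by move=> j tj; rewrite !linearD !linearZ /= ux // vy.
have absC : absorbing C.
  move=> y; have [x _ <-] : range T y by rewrite surjT.
  have [c c0 xc] := absorbing_slab phi s e e0 x.
  exists c => // t'; exists (c *: x); first exact: sU.
  by move=> j _; rewrite linearZ.
(* It remains to see that [C] contains the common kernel of the [psi j] for [j]
   in [t], where [t] comes from the stabilization of the spaces [W t]. *)
have [|d d0 dC] := slab_sub psi t C acC absC; last by exists t, d.
move=> y yt t'; have [x _ xy] : range T y by rewrite surjT.
have PW : range W (W t') by exists t'.
have [|v Wv vx] := stabW _ PW x; first by move=> j tj; rewrite xy yt.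
exists (x - v).
  by apply: sU => i si; rewrite linearB /= vx // subrr normr0.
by move=> j tj; rewrite !linearB /= Wv // subr0 xy.
Qed.

(** * The pointwise topology *)

Section pointwise_topology.
Context {R : realType} {X : topologicalType}.

(** A copy of [Cp_fun] with the point as first argument, so that the evaluation
    at a point can carry the structure of a linear functional. *)
Definition Cp_eval (x : X) (f : Cp R X) : R := Cp_fun f x.

Lemma Cp_eval_linear (x : X) : linear_for *%R (Cp_eval x).
Proof. by []. Qed.

HB.instance Definition _ (x : X) :=
  GRing.isLinear.Build R (Cp R X) R *%R (Cp_eval x) (Cp_eval_linear x).

Lemma Cp_nbhsP (f : Cp R X) (A : set (Cp R X)) :
  nbhs f A <-> exists s : seq X, exists2 e : R, 0 < e &
    forall g, slab Cp_eval s e (g - f) -> A g.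
Proof.
split.
  (* The right-hand side defines a filter; it converges to [f] pointwise, hence
     in the topology of [Cp R X]. *)
  pose F : set_system (Cp R X) :=
    [set A | exists s : seq X, exists2 e : R, 0 < e &
      forall g, slab Cp_eval s e (g - f) -> A g].
  have FF : Filter F.
    split.
    - by exists [::], 1.
    - move=> P Q [s [d d0 sP]] [t [e e0 tQ]]; exists (s ++ t), (Num.min d e).
        by rewrite lt_min d0.
      move=> g stg; split; [apply: sP|apply: tQ] => x xs.
        by have := stg x; rewrite mem_cat xs lt_min => /(_ isT)/andP[].
      by have := stg x; rewrite mem_cat xs orbT lt_min => /(_ isT)/andP[].
    - by move=> P Q PQ [s [e e0 sP]]; exists s, e => // g /sP/PQ.
  have cvF : {ptws, Cp_fun @ F --> Cp_fun f}.
    apply/pointwise_cvgP => x; apply/cvgrPdist_lt => e e0.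
    exists [:: x], e => // g gf; rewrite /= distrC.
    by apply: gf; rewrite inE.
  rewrite nbhsE => -[B [[B' oB' <-] B'f] BA].
  suff [s [e e0 sB]] : F (Cp_fun @^-1` B') by exists s, e => // g /sB/BA.
  by apply: cvF; exact: open_nbhs_nbhs.
move=> [s [e e0 sA]].
have evc x : continuous (Cp_eval x).
  move=> g; apply: (@continuous_comp _ _ _
    (Cp_fun : Cp R X -> {ptws X -> R}) (fun h => h x)).
    exact: initial_continuous.
  exact: proj_continuous.
have : \forall g \near f, forall x, x \in s -> `|Cp_eval x (g - f)| < e.
  elim: s {sA} => [|x s IH]; first by apply: filterE.
  have fx : \forall g \near f, `|Cp_eval x (g - f)| < e.
    have /cvgrPdist_lt/(_ e e0) := evc x f; apply: filterS => g.
    by rewrite distrC linearB.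
  by apply: filterS2 fx IH => g gx gs y; rewrite inE => /predU1P[->|/gs].
by apply: filterS => g; exact: sA.
Qed.

Lemma nbhs0_scale (a : R) (A : set (Cp R X)) :
  a != 0 -> nbhs 0 A -> nbhs 0 ( *:%R a @` A).
Proof.
move=> a0 /Cp_nbhsP[s [e e0 sA]]; apply/Cp_nbhsP.
exists s, (`|a| * e); first by rewrite mulr_gt0 ?normr_gt0.
move=> g; rewrite subr0 => sg.
exists (a^-1 *: g); last by rewrite scalerA divff ?scale1r.
apply: sA => x xs; rewrite subr0 linearZ /= normrM normfV mulrC.
by rewrite ltr_pdivrMr ?normr_gt0 // mulrC sg.
Qed.

Lemma nbhs_base_slabs :
  nbhs_base (0 : Cp R X)
    [set U | exists s e, 0 < e /\ U = slab Cp_eval s e].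
Proof.
split=> [_ [s [e [e0 ->]]]|A /Cp_nbhsP[s [e e0 sA]]].
  by apply/Cp_nbhsP; exists s, e => // g; rewrite subr0.
exists (slab Cp_eval s e); first by exists s, e.
by move=> g sg; apply: sA; rewrite subr0.
Qed.

(** A point of the closure of [C] differs from a point of [C] by an element of
    the symmetric neighbourhood [C], and [C + C = 2 C] by convexity. *)
Lemma closure_sub_twice (C : set (Cp R X)) :
  absolutely_convex C -> nbhs 0 C -> closure C `<=` *:%R 2 @` C.
Proof.
move=> /absolutely_convexP C2 /Cp_nbhsP[s [e e0 sC]] y clCy.
have [|u [Cu uy]] := clCy [set z | slab Cp_eval s e (z - y)].
  by apply/Cp_nbhsP; exists s, e.
have Cyu : C (y - u).
  by apply: sC => x xs; rewrite subr0 -opprB linearN normrN; exact: uy.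
exists (2^-1 *: u + 2^-1 *: (y - u)).
  by apply: C2 => //; rewrite ger0_norm //; lra.
by rewrite -scalerDr subrKC scalerA divff ?scale1r.
Qed.

End pointwise_topology.

(** * Linear maps between spaces of continuous functions *)

Section linear_surjection.
Context {R : realType} {X Y : topologicalType} (T : {linear Cp R X -> Cp R Y}).

Lemma absolutely_convex_image (U : set (Cp R X)) :
  absolutely_convex U -> absolutely_convex (T @` U).
Proof.
move=> /absolutely_convexP U2; apply/absolutely_convexP.
move=> a b _ _ ab [u Uu <-] [v Uv <-].
by exists (a *: u + b *: v); [exact: U2|rewrite linearD !linearZ].
Qed.

(** Exact agreement on every finite set of points is more than pointwise
    closure asks for, so the almost openness of [T] specializes to the
    evaluation functionals. *)
Lemma nbhs0_closure_image (U : set (Cp R X)) :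
  range T = setT -> absolutely_convex U -> nbhs 0 U ->
  nbhs 0 (closure (T @` U)).
Proof.
move=> surjT acU /Cp_nbhsP[s [e e0 sU]].
have [|t [d d0 tU]] :=
  linear_surjection_almost_open _ _ _ _ _ Cp_eval Cp_eval T s e U surjT acU e0.
  by move=> u su; apply: sU; rewrite subr0.
apply/Cp_nbhsP; exists t, d => // y; rewrite subr0 => yt.
move=> B /Cp_nbhsP[t' [r r0 tB]].
have [u Uu uy] := tU y yt t'; exists (T u); split; first by exists u.
by apply: tB => j tj; rewrite linearB /= uy // subrr normr0.
Qed.

(** Translation invariance of the pointwise topology, read off [Cp_nbhsP], moves
    the hypothesis from [0] to any point. *)
Lemma open_map_nbhs0 :
  (forall A, nbhs 0 A -> nbhs 0 (T @` A)) -> open_map T.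
Proof.
move=> T0 A oA; rewrite openE => _ [f Af <-].
have /Cp_nbhsP[s [e e0 sA]] : nbhs f A by exact: open_nbhs_nbhs.
have /T0/Cp_nbhsP[t [d d0 tA]] : nbhs 0 (slab Cp_eval s e).
  by apply/Cp_nbhsP; exists s, e => // g; rewrite subr0.
apply/Cp_nbhsP; exists t, d => // y yt.
have [|u su uy] := tA (y - T f); first by rewrite subr0.
exists (u + f); last by rewrite linearD uy subrK.
by apply: sA; rewrite addrK.
Qed.

End linear_surjection.

Theorem theorem1p3 (R : realType) (X Y : topologicalType)
    (tychX : tychonoff_space X) (tychY : tychonoff_space Y)
    (deltaX : delta_space X)
    (T : {linear Cp R X -> Cp R Y})
    (contT : continuous T) (surjT : range T = [set: Cp R Y]) :
  let assertion1 :=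
    exists B : set (set (Cp R X)),
      [/\ nbhs_base 0 B,
          forall U, B U -> absolutely_convex U
        & forall U, B U -> closure (T @` U) `<=` *:%R 2 @` (T @` U)] in
  let assertion2 := open_map T in
  let assertion3 :=
    exists B : set (set (Cp R X)),
      [/\ nbhs_base 0 B,
          forall U, B U -> absolutely_convex U /\ closed U
        & forall U, B U -> closed (T @` U)] in
  (assertion3 -> assertion2) /\ (assertion2 <-> assertion1).
Proof.
move=> assertion1 assertion2 assertion3.
have a3_a1 : assertion3 -> assertion1.
  move=> [B [baseB acB clB]]; exists B; split=> // U BU.
    by have [] := acB U BU.
  rewrite -(closure_id _).1; last exact: clB.
  move=> y TUy; exists (2^-1 *: y); last by rewrite scalerA divff ?scale1r.
  have [_ balTU] := absolutely_convex_image T U (acB U BU).1.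
  by apply: balTU TUy; rewrite ger0_norm //; lra.
have a1_a2 : assertion1 -> assertion2.
  move=> [B [baseB acB clB]]; apply: open_map_nbhs0 => A /baseB.2[U BU UA].
  have := nbhs0_closure_image T U surjT (acB U BU) (baseB.1 U BU).
  move=> /(nbhs0_scale (2^-1)); rewrite invr_eq0 pnatr_eq0 => /(_ isT).
  apply: filterS => _ [_ /(clB U BU)[_ [u Uu <-] <-] <-].
  by rewrite scalerA mulVf // scale1r; exists u => //; exact: UA.
have a2_a1 : assertion2 -> assertion1.
  move=> openT; exists [set U | exists s e, 0 < e /\ U = slab Cp_eval s e].
  split=> [|_ [s [e [e0 ->]]]|U BU]; first exact: nbhs_base_slabs.
    exact: absolutely_convex_slab.
  have acU : absolutely_convex U.
    by have [s [e [e0 ->]]] := BU; exact: absolutely_convex_slab.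
  apply: closure_sub_twice; first exact: absolutely_convex_image.
  have : nbhs 0 (T @` U^°).
    apply: open_nbhs_nbhs; split; first by apply: openT; exact: open_interior.
    by exists 0; [exact: nbhs_base_slabs.1|rewrite linear0].
  by apply: filterS; apply: image_subset; exact: interior_subset.
by split=> [/a3_a1/a1_a2|].
Qed.
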